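(* There are $2^{\aleph_0}$ countable Borel quasi-orders $Q$, pairwise not Borel bireducible, such that the associated equivalence relation $E_Q$ is a universal countable Borel equivalence relation.
   Context: A countable Borel quasi-order is a Borel quasi-order on a standard Borel space in which every element has only countably many predecessors. For a quasi-order $Q$ on $X$, $E_Q$ is the equivalence relation $x\mathbin{E_Q}y\Leftrightarrow (x\mathbin{Q}y\wedge y\mathbin{Q}x)$. $Q\leq_B Q'$ means there is a Borel $f$ with $x\mathbin{Q}y\Leftrightarrow f(x)\mathbin{Q'}f(y)$; $Q,Q'$ are Borel bireducible if $Q\leq_B Q'$ and $Q'\leq_B Q$. A countable Borel equivalence relation (Borel equivalence relation with countable classes) is universal if every countable Borel equivalence relation Borel reduces to it. *)

(* Defs.v *)
From Stdlib Require Import RelationClasses.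
From mathcomp Require Import all_boot all_order all_algebra.
From mathcomp Require Import boolp classical_sets functions cardinality.
From mathcomp Require Import reals topology measure.

Set Implicit Arguments.
Unset Strict Implicit.
Unset Printing Implicit Defensive.

Local Open Scope classical_set_scope.

Definition separable (T : topologicalType) :=
  exists2 D : set T, countable D & dense D.

Definition complete_metric (R : realType) (M : metricType R) :=
  forall u : nat -> M, cauchy (u @ \oo) -> exists l : M, u @ \oo --> l.

(* [X] is isomorphic, as a measurable space, to a Polish space (a complete
   separable metric space [M]) with its Borel sets. Since [f] is bijective,
   every subset of [X] is some [f @^-1` B], so the last clause says that both
   [f] and its inverse are Borel. A [measurableType] is inhabited by
   definition: only the empty standard Borel space is left out, and the
   relation on it reduces to every other one and is not universal. *)
Definition standard_borel (R : realType) (d : measure_display)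
    (X : measurableType d) :=
  exists (M : metricType R) (f : X -> M),
    [/\ complete_metric M, separable M, bijective f &
        forall B : set M, measurable (f @^-1` B) <-> <<s @open M >> B].

Definition borel_relation (d : measure_display) (X : measurableType d)
    (Q : X -> X -> Prop) :=
  measurable [set p : X * X | Q p.1 p.2].

Definition countable_borel_quasi_order (d : measure_display)
    (X : measurableType d) (Q : X -> X -> Prop) :=
  [/\ PreOrder Q, borel_relation Q & forall x, countable [set y | Q y x]].

Definition countable_borel_equivalence (d : measure_display)
    (X : measurableType d) (E : X -> X -> Prop) :=
  [/\ Equivalence E, borel_relation E & forall x, countable [set y | E y x]].

Definition assoc_equiv (X : Type) (Q : X -> X -> Prop) : X -> X -> Prop :=
  fun x y => Q x y /\ Q y x.

Definition borel_reducible (d d' : measure_display) (X : measurableType d)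
    (X' : measurableType d') (Q : X -> X -> Prop) (Q' : X' -> X' -> Prop) :=
  exists2 f : X -> X', measurable_fun setT f &
    forall x y, Q x y <-> Q' (f x) (f y).

Definition borel_bireducible (d d' : measure_display) (X : measurableType d)
    (X' : measurableType d') (Q : X -> X -> Prop) (Q' : X' -> X' -> Prop) :=
  borel_reducible Q Q' /\ borel_reducible Q' Q.

Definition universal_countable_borel_equivalence (R : realType)
    (d : measure_display) (X : measurableType d) (E : X -> X -> Prop) :=
  countable_borel_equivalence E /\
  forall (d' : measure_display) (Y : measurableType d') (F : Y -> Y -> Prop),
    standard_borel R Y -> countable_borel_equivalence F -> borel_reducible F E.

(* Main.v *)
Require Import Defs.
From Stdlib Require Import RelationClasses.
From HB Require Import structures.
From mathcomp Require Import all_boot all_order all_algebra.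
From mathcomp Require Import boolp classical_sets functions cardinality.
From mathcomp Require Import reals topology measure.
From mathcomp Require Import lra zify.

(** Given a universal countable Borel equivalence relation [E], the disjoint
    union of [E] and of a countable set of finite connected posets is a
    countable Borel quasi-order whose associated equivalence relation is still
    universal. A reduction maps strictly comparable points to strictly
    comparable points, hence embeds each of the finite posets into one of those
    of the target. The crowns (cycles, ordered as bipartite graphs) form an
    infinite antichain under embedding, so the subsets of this antichain give
    pairwise non-bireducible quasi-orders.

    For [E] we take points [p] of [2^nat] indexed by words, two of them being
    equivalent when each is a shift of the other. If the classes of [F] are
    enumerated by Borel functions [f_n], then [x] is sent to the family of all
    [f_w x], for [w] a word. The functions [f_n] are provided by the
    Lusin-Novikov theorem. Its proof here is by induction on the well-founded
    tree of finite configurations of basic pieces of a Souslin scheme for [F]: an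
    infinite branch would produce a perfect set inside a class. *)

Set Implicit Arguments.
Unset Strict Implicit.
Unset Printing Implicit Defensive.

Import Order.TTheory GRing.Theory Num.Theory.
Local Open Scope classical_set_scope.

(** * Borel sets of products of two-point spaces *)

Definition bits (J : countType) : Type := J -> bool.
HB.instance Definition _ J := Pointed.on (bits J).

Definition coordinate_sets (J : countType) : set (set (bits J)) :=
  [set [set z : bits J | z j] | j in setT].

Definition bits_display : measure_display.
Proof. exact: default_measure_display. Qed.

HB.instance Definition _ J := @isMeasurable.Build bits_display (bits J)
  <<s @coordinate_sets J >> (@sigma_algebra0 _ setT _) (@sigma_algebraC _ _)
  (@sigma_algebra_bigcup _ setT _).

Section measurable_predicates.
Context d (T : measurableType d).
Implicit Types P Q : T -> Prop.

Lemma measurable_ex (K : countType) (P : K -> T -> Prop) :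
  (forall k, measurable [set x | P k x]) -> measurable [set x | exists k, P k x].
Proof.
move=> mP; rewrite (_ : [set _ | _] = \bigcup_k [set x | P k x]); last first.
  by apply/seteqP; split=> x /= [k]; [exists k|exists k].
exact: countable_bigcupT_measurable.
Qed.

Lemma measurable_not P : measurable [set x | P x] -> measurable [set x | ~ P x].
Proof. exact: measurableC. Qed.

Lemma measurable_all (K : countType) (P : K -> T -> Prop) :
  (forall k, measurable [set x | P k x]) -> measurable [set x | forall k, P k x].
Proof.
move=> mP; rewrite (_ : [set _ | _] = [set x | ~ exists k, ~ P k x]).
  by apply/measurable_not/measurable_ex => k; exact/measurable_not.
by apply/seteqP; split=> x /=; rewrite -forallNP => H k; [move/(_ (H k))|exact: contrapT].
Qed.

Lemma measurable_conj P Q : measurable [set x | P x] -> measurable [set x | Q x] ->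
  measurable [set x | P x /\ Q x].
Proof. exact: measurableI. Qed.

Lemma measurable_disj P Q : measurable [set x | P x] -> measurable [set x | Q x] ->
  measurable [set x | P x \/ Q x].
Proof. exact: measurableU. Qed.

Lemma measurable_cstP (P : Prop) : measurable [set x : T | P].
Proof.
have [p|np] := pselect P.
  by rewrite (_ : [set _ | _] = setT)//; apply/seteqP; split.
by rewrite (_ : [set _ | _] = set0)//; apply/seteqP; split.
Qed.

Lemma measurable_iff P Q : measurable [set x | P x] -> measurable [set x | Q x] ->
  measurable [set x | P x <-> Q x].
Proof.
move=> mP mQ.
rewrite (_ : [set _ | _] =
    [set x | (P x /\ Q x) \/ (~ P x /\ ~ Q x)]); last first.
  apply/seteqP; split=> x /=; last by tauto.
  by have [] := pselect (P x); tauto.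
by apply: measurable_disj; apply: measurable_conj => //; exact: measurable_not.
Qed.

Lemma measurable_coord J (f : T -> bits J) j :
  measurable_fun setT f -> measurable [set x | f x j].
Proof.
move=> /(_ measurableT [set z | z j]); rewrite setTI; apply.
by apply: sub_sigma_algebra; exists j.
Qed.

Lemma measurable_to_bits J (f : T -> bits J) :
  (forall j, measurable [set x | f x j]) -> measurable_fun setT f.
Proof.
move=> mf; apply: (@measurability _ _ _ _ _ _ (@coordinate_sets J)) => //.
by move=> _ [_ [j _ <-] <-]; rewrite setTI; exact: mf.
Qed.

Lemma measurable_eq_bits J (f g : T -> bits J) :
  measurable_fun setT f -> measurable_fun setT g ->
  measurable [set x | f x = g x].
Proof.
move=> mf mg; rewrite (_ : [set _ | _] = [set x | forall j, f x j <-> g x j]).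
  by apply: measurable_all => j; apply: measurable_iff; exact: measurable_coord.
apply/seteqP; split=> [x /= ->//|x /= H].
by apply/funext => j; apply/idP/idP => /H.
Qed.

Lemma measurable_preim d' (T' : measurableType d') (f : T -> T') (A : set T') :
  measurable_fun setT f -> measurable A -> measurable [set x | A (f x)].
Proof. by move=> mf mA; have := mf measurableT A mA; rewrite setTI. Qed.

End measurable_predicates.

Lemma measurable_reindex (J K : countType) (f : J -> K) :
  measurable_fun setT ((fun z => z \o f) : bits K -> bits J).
Proof. by apply: measurable_to_bits => j; apply: sub_sigma_algebra; exists (f j). Qed.

Lemma measurable_coord_eq (J : countType) (j : J) (b : bool) :
  measurable [set z : bits J | z j = b].
Proof.
have mj : measurable [set z : bits J | z j] by apply: sub_sigma_algebra; exists j.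
case: b => //; rewrite (_ : [set z | _] = ~` [set z : bits J | z j]).
  exact: measurableC.
by apply/seteqP; split=> z /=; [move=> ->|move/negP/negbTE].
Qed.

(** * Analytic sets *)

Definition agree (n : nat) (a b : nat -> nat) := forall i, (i < n)%N -> a i = b i.

Definition baire_closed (D : set (nat -> nat)) :=
  forall a, (forall n, exists2 b, D b & agree n a b) -> D a.

Definition baire_continuous J (phi : (nat -> nat) -> bits J) :=
  forall j a, exists n, forall b, agree n a b -> phi b j = phi a j.

(** Allowing a closed domain [D] covers the empty set and lets equations between continuous maps be
    imposed on the domain. *)
Definition analytic J (A : set (bits J)) := exists D phi,
  [/\ baire_closed D, @baire_continuous J phi & A = phi @` D].

Definition node (s : seq nat) : set (nat -> nat) :=
  [set a | mkseq a (size s) = s].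

Lemma agree_leq m n a b : (m <= n)%N -> agree n a b -> agree m a b.
Proof. by move=> mn ab i im; apply: ab; apply: leq_trans im mn. Qed.

Lemma node_agree n a b : node (mkseq a n) b <-> agree n a b.
Proof.
rewrite /node /= size_mkseq; split => [H i ilt|H].
  by rewrite -(nth_mkseq 0 a ilt) -H nth_mkseq.
by apply/eq_in_map => i; rewrite mem_iota add0n => /andP[_ /H ->].
Qed.

Lemma nodeE s a : node s a -> s = mkseq a (size s).
Proof. by move=> ->. Qed.

Lemma node_closed s : baire_closed (node s).
Proof.
move=> a /(_ (size s))[b sb ab]; rewrite (nodeE sb).
by apply/node_agree => i /ab.
Qed.

Lemma baire_closedI D E : baire_closed D -> baire_closed E ->
  baire_closed (D `&` E).
Proof.
by move=> cD cE a H; split; [apply: cD|apply: cE] => n;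
  have [b [Db Eb] ab] := H n; exists b.
Qed.

(** Entry [i] of the limit is read off [s i.+1], which is long enough to have one; all later words
    agree with it. *)
Lemma node_limit (s : nat -> seq nat) :
  (forall n, prefix (s n) (s n.+1)) -> (forall n, (n <= size (s n))%N) ->
  exists a, forall n, node (s n) a.
Proof.
move=> ps ns; exists (fun i => nth 0 (s i.+1) i) => n.
have mono m k : (m <= k)%N -> prefix (s m) (s k).
  elim: k => [|k IH]; first by rewrite leqn0 => /eqP ->; exact: prefix_refl.
  rewrite leq_eqVlt => /orP[/eqP ->|mk]; first exact: prefix_refl.
  exact: prefix_trans (IH mk) (ps k).
have pnth m k i : (m <= k)%N -> (i < size (s m))%N -> nth 0 (s k) i = nth 0 (s m) i.
  by move=> /mono /prefixP[t ->] im; rewrite nth_cat im.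
rewrite /node /=; apply: (@eq_from_nth _ 0) => [|i]; rewrite size_mkseq// => il.
rewrite nth_mkseq//.
have [ni|ni] := leqP n i.+1; first by rewrite (pnth n).
by rewrite -(pnth i.+1 n)// ltnW.
Qed.

Lemma node_rcons s a : node s a <-> exists k, node (rcons s k) a.
Proof.
split=> [sa|[k]].
  by exists (a (size s)); rewrite /node/= size_rcons mkseqS sa.
by rewrite /node/= size_rcons mkseqS => /rcons_inj[].
Qed.

Definition slice (i : nat) (a : nat -> nat) : nat -> nat := fun m => a (pickle (i, m)).

Definition glue (f : nat -> nat -> nat) : nat -> nat := fun k =>
  if @unpickle (nat * nat)%type k is Some (i, m) then f i m else 0.

Lemma slice_glue i f : slice i (glue f) = f i.
Proof. by apply/funext => m; rewrite /slice /glue pickleK. Qed.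

Lemma slice_agree i n : exists N, forall a b, agree N a b -> agree n (slice i a) (slice i b).
Proof.
exists (\max_(m < n) pickle (i, m : nat)).+1 => a b ab m mn; apply: ab.
by rewrite ltnS (leq_bigmax (Ordinal mn)).
Qed.

Lemma continuous_slice J (phi : _ -> bits J) i :
  baire_continuous phi -> baire_continuous (phi \o slice i).
Proof.
move=> cphi j a; have [n H] := cphi j (slice i a).
by have [N HN] := slice_agree i n; exists N => b /HN /H.
Qed.

Lemma closed_slice D i : baire_closed D -> baire_closed [set a | D (slice i a)].
Proof.
move=> cD a H; apply: cD => n; have [N HN] := slice_agree i n.
by have [b Db /HN] := H N; exists (slice i b).
Qed.

Lemma closed_eq J (phi psi : _ -> bits J) :
  baire_continuous phi -> baire_continuous psi ->
  baire_closed [set a | phi a = psi a].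
Proof.
move=> cphi cpsi a H; apply/funext => j.
have [n Hn] := cphi j a; have [m Hm] := cpsi j a.
have [b /= eb ab] := H (maxn n m).
rewrite -(Hn b) ?eb ?(Hm b)//; apply: agree_leq ab; [exact: leq_maxr|exact: leq_maxl].
Qed.

Lemma closed_all (I : Type) (D : I -> set (nat -> nat)) :
  (forall i, baire_closed (D i)) -> baire_closed [set a | forall i, D i a].
Proof.
by move=> cD a H i; apply: cD => n; have [b Db ab] := H n; exists b.
Qed.

(** A point codes, slice by slice, one candidate preimage for each [A i]; the closed condition that
    all images agree leaves exactly the intersection. *)
Lemma analytic_bigcap J (A : nat -> set (bits J)) :
  (forall n, analytic (A n)) -> analytic (\bigcap_n A n).
Proof.
move=> /choice[D] /choice[phi] H.
exists [set a | forall i, D i (slice i a) /\ phi i (slice i a) = phi 0 (slice 0 a)].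
exists (phi 0 \o slice 0); split.
- apply: closed_all => i; apply: baire_closedI.
    by apply: closed_slice; have [] := H i.
  by apply: closed_eq; apply: continuous_slice;
    [have [] := H i|have [] := H 0].
- by apply: continuous_slice; have [] := H 0.
- apply/seteqP; split=> [z Az|_ [a Ha <-] i _].
    have /choice[f Hf] : forall i, exists a, D i a /\ phi i a = z.
      by move=> i; have [_ _ /seteqP[/(_ z (Az i I))[a]]] := H i; exists a.
    exists (glue f) => [i|]; rewrite /= !slice_glue; last by have [] := Hf 0.
    by have [? ->] := Hf i; have [_ ->] := Hf 0.
  have [_ _ ->] := H i; have [Di e] := Ha i.
  by exists (slice i a).
Qed.

(** The first entry of a point chooses the set, the remaining entries a point of its domain. *)
Lemma analytic_bigcup J (A : nat -> set (bits J)) :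
  (forall n, analytic (A n)) -> analytic (\bigcup_n A n).
Proof.
move=> /choice[D] /choice[phi] H.
pose sh (a : nat -> nat) : nat -> nat := fun i => a i.+1.
have sh_agree n a b : agree n.+1 a b -> agree n (sh a) (sh b).
  by move=> ab i ilt; apply: ab.
exists [set a | D (a 0) (sh a)], (fun a => phi (a 0) (sh a)); split.
- move=> a Ha /=; have [cD _ _] := H (a 0); apply: cD => n.
  have [b /= Db ab] := Ha n.+1; exists (sh b); last exact: sh_agree.
  by rewrite (ab 0).
- move=> j a; have [_ cphi _] := H (a 0); have [n Hn] := cphi j (sh a).
  by exists n.+1 => b ab; rewrite -(ab 0)//; apply/Hn/sh_agree.
- apply/seteqP; split=> [z [n _ Az]|_ [a /= Da <-]].
    have [_ _ /seteqP[/(_ z Az)[a Da <-] _]] := H n.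
    by exists (fun i => if i is k.+1 then a k else n).
  by exists (a 0) => //; have [_ _ ->] := H (a 0); exists (sh a).
Qed.


Definition baire_bits J (a : nat -> nat) : bits J := fun j => a (pickle j) != 0.

Lemma continuous_baire_bits J : baire_continuous (@baire_bits J).
Proof.
by move=> j a; exists (pickle j).+1 => b ab; rewrite /baire_bits (ab (pickle j)).
Qed.

Lemma baire_bits_surj J (z : bits J) : exists a, baire_bits a = z.
Proof.
exists (fun k => if @unpickle J k is Some j then nat_of_bool (z j) else 0).
by apply/funext => j; rewrite /baire_bits pickleK; case: (z j).
Qed.

Lemma analyticT J : analytic [set: bits J].
Proof.
exists setT, (@baire_bits J); split=> //; first exact: continuous_baire_bits.
by apply/seteqP; split=> // z _; have [a <-] := baire_bits_surj z; exists a.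
Qed.

Lemma analytic0 J : analytic (@set0 (bits J)).
Proof.
exists set0, (fun=> point); split.
- by move=> a /(_ 0)[].
- by move=> j a; exists 0.
- by rewrite image_set0.
Qed.

Lemma analyticI J (A B : set (bits J)) :
  analytic A -> analytic B -> analytic (A `&` B).
Proof.
by move=> aA aB; rewrite -bigcap2E; apply: analytic_bigcap => -[|[|n]] //=;
  exact: analyticT.
Qed.

Lemma analytic_coord J j b : analytic [set z : bits J | z j = b].
Proof.
exists [set a | @baire_bits J a j = b], (@baire_bits J); split.
- move=> a Ha /=; have [n Hn] := continuous_baire_bits j a.
  by have [c /= <- /Hn] := Ha n.
- exact: continuous_baire_bits.
- apply/seteqP; split=> [z /= zj|_ [a /= ? <-]//].
  by have [a az] := baire_bits_surj z; exists a => //=; rewrite az.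
Qed.

(** Sets that are analytic together with their complement form a sigma-algebra containing the
    coordinate sets. *)
Lemma analytic_measurable J (A : set (bits J)) : measurable A -> analytic A.
Proof.
suff : @measurable _ (bits J) `<=` [set A | analytic A /\ analytic (~` A)].
  by move=> H /H[].
apply: smallest_sub => [|_ [j _ <-]]; last first.
  split; first exact: analytic_coord.
  rewrite (_ : ~` _ = [set z | z j = false]); first exact: analytic_coord.
  by apply/seteqP; split=> z /=; [move/negP/negbTE|move=> ->].
split.
- by split; [exact: analytic0|rewrite setC0; exact: analyticT].
- by move=> B [aB aCB]; split; rewrite setTD ?setCK.
- move=> F HF; split; first by apply: analytic_bigcup => n; have [] := HF n.
  by rewrite setC_bigcup; apply: analytic_bigcap => n; have [] := HF n.
Qed.

Lemma analytic_reindex (J K : countType) (f : J -> K) (A : set (bits K)) :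
  analytic A -> analytic ((fun z => z \o f : bits J) @` A).
Proof.
move=> [D [phi [cD cphi ->]]]; exists D, (fun a => phi a \o f); split=> //.
- by move=> j a; have [n Hn] := cphi (f j) a; exists n.
- by rewrite image_comp.
Qed.

(** * Lusin separation *)

Section separation.
Context (J : countType).
Implicit Types P Q : set (bits J).

Definition separated P Q :=
  exists C, [/\ measurable C, P `<=` C & Q `<=` ~` C].

(** Intersecting the separators of [P i] over all [j] keeps [P i] and avoids every [Q j]. *)
Lemma separated_bigcup (P Q : nat -> set (bits J)) :
  (forall i j, separated (P i) (Q j)) ->
  separated (\bigcup_i P i) (\bigcup_j Q j).
Proof.
move=> H0; have H i := choice (H0 i).
have /choice[C HC] : forall i, exists C : nat -> set (bits J), forall j,
   [/\ measurable (C j), P i `<=` C j & Q j `<=` ~` C j].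
  by move=> i; have [C HC] := H i; exists C.
exists (\bigcup_i \bigcap_j C i j); split.
- apply: bigcupT_measurable => i; apply: bigcapT_measurable => j.
  by have [] := HC i j.
- move=> z [i _ Pz]; exists i => // j _.
  by have [_ /(_ _ Pz)] := HC i j.
- move=> z [j _ Qz] [i _ /(_ j I)].
  by have [_ _ /(_ _ Qz)] := HC i j.
Qed.

(* If two disjoint analytic sets were not separated, refining both Souslin
   schemes along a non-separated branch would produce two points [phi a] and
   [psi b], which differ at some coordinate; that coordinate separates. *)
Lemma analytic_separation A B : analytic A -> analytic B ->
  A `&` B = set0 -> separated A B.
Proof.
move=> [D [phi [cD cphi ->]]] [E [psi [cE cpsi ->]]] AB0.
apply: contrapT => nsep.
pose bad (st : seq nat * seq nat) :=
  ~ separated (phi @` (D `&` node st.1)) (psi @` (E `&` node st.2)).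
have bad0 : bad ([::], [::]).
  have e F : F `&` node [::] = F by apply/seteqP; split=> [? []|].
  by rewrite /bad /= !e.
have badS st : bad st -> exists ij, bad (rcons st.1 ij.1, rcons st.2 ij.2).
  move=> bst; apply: contrapT => /forallNP H; apply: bst.
  have -> : phi @` (D `&` node st.1) =
      \bigcup_i (phi @` (D `&` node (rcons st.1 i))).
    apply/seteqP; split=> [_ [a [Da /node_rcons[k ka]] <-]|_ [k _ [a [Da ka] <-]]].
      by exists k => //; exists a.
    by exists a => //; split=> //; apply/node_rcons; exists k.
  have -> : psi @` (E `&` node st.2) =
      \bigcup_i (psi @` (E `&` node (rcons st.2 i))).
    apply/seteqP; split=> [_ [a [Da /node_rcons[k ka]] <-]|_ [k _ [a [Da ka] <-]]].
      by exists k => //; exists a.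
    by exists a => //; split=> //; apply/node_rcons; exists k.
  by apply: separated_bigcup => i j; have /contrapT := H (i, j).
have /choice[nxt Hnxt] : forall st, exists ij, bad st -> bad (rcons st.1 ij.1, rcons st.2 ij.2).
  move=> st; have [/badS[ij ?]|nb] := pselect (bad st); first by exists ij.
  by exists (0, 0) => /nb.
pose chain := fix chain n := if n is m.+1 then
   let st := chain m in (rcons st.1 (nxt st).1, rcons st.2 (nxt st).2)
  else ([::], [::]) : seq nat * seq nat.
have badn n : bad (chain n) by elim: n => //= n IH; exact: Hnxt.
have sz1 n : size (chain n).1 = n by elim: n => //= n IH; rewrite size_rcons IH.
have sz2 n : size (chain n).2 = n by elim: n => //= n IH; rewrite size_rcons IH.
have [a Ha] : exists a, forall n, node (chain n).1 a.
  by apply: node_limit => n; rewrite ?sz1//= -cats1; exact: prefix_prefix.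
have [b Hb] : exists b, forall n, node (chain n).2 b.
  by apply: node_limit => n; rewrite ?sz2//= -cats1; exact: prefix_prefix.
have agr1 n c : node (chain n).1 c -> agree n a c.
  by rewrite (nodeE (Ha n)) sz1 => /node_agree.
have agr2 n c : node (chain n).2 c -> agree n b c.
  by rewrite (nodeE (Hb n)) sz2 => /node_agree.
(* An empty piece would be separated by [set0] or [setT]. So no piece is empty, and closedness puts
   the limits in [D] and [E]. *)
have nonempty n : (exists2 c, D c & node (chain n).1 c) /\
    (exists2 c, E c & node (chain n).2 c).
  split; apply: contrapT => H; apply: (badn n).
    exists set0; split; rewrite ?setC0// => z [c [Dc nc] _].
    by apply: H; exists c.
  exists setT; split; rewrite ?setCT// => z [c [Dc nc] _].
  by apply: H; exists c.
have Da : D a.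
  by apply: cD => n; have [[c Dc /agr1 ac] _] := nonempty n; exists c.
have Eb : E b.
  by apply: cE => n; have [_ [c Dc /agr2 ac]] := nonempty n; exists c.
have [j neq] : exists j, phi a j != psi b j.
  apply: contrapT => /forallNP H.
  have e : phi a = psi b by apply/funext => j; have /negP/negPn/eqP := H j.
  have : (phi @` D `&` psi @` E) (phi a) by split; [exists a|exists b].
  by rewrite AB0.
have [n Hn] := cphi j a; have [m Hm] := cpsi j b.
apply: (badn (maxn n m)); exists [set z | z j = phi a j]; split.
- exact: measurable_coord_eq.
- move=> _ [c [Dc /agr1 nc] <-] /=; apply: Hn; apply: agree_leq nc; exact: leq_maxl.
- move=> _ [c [Dc /agr2 nc] <-] /=; rewrite Hm.
    by move/eqP; rewrite eq_sym (negbTE neq).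
  apply: agree_leq nc; exact: leq_maxr.
Qed.

(** Induction on the list of indices, inside an analytic set [R]: the head [B i] is separated from
    the part of [R] common to the remaining sets, and the separator cuts [R] down for the next
    step. *)
Lemma analytic_separation_fin (I : finType) (B : I -> set (bits J)) :
  (forall i, analytic (B i)) -> (forall z, ~ forall i, B i z) ->
  exists C : I -> set (bits J), [/\ forall i, measurable (C i),
    forall i, B i `<=` C i & forall z, ~ forall i, C i z].
Proof.
move=> aB B0.
suff H (l : seq I) : forall R : set (bits J), analytic R ->
    (forall z, R z -> ~ forall i, i \in l -> B i z) ->
    exists C : I -> set (bits J), [/\ forall i, measurable (C i),
      forall i, B i `<=` C i & forall z, R z -> ~ forall i, i \in l -> C i z].
  have [|C [mC BC C0]] := H (enum I) setT (analyticT J).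
    by move=> z _ Bz; apply: (B0 z) => i; apply: Bz; rewrite mem_enum.
  by exists C; split=> // z Cz; apply: (C0 z).
elim: l => [|i l IH] R aR H.
  by exists (fun=> setT); split=> // z /H[].
have aS : analytic (R `&` \bigcap_(k in [set` l]) B k).
  apply: analyticI => //.
  have -> : \bigcap_(k in [set` l]) B k =
     \bigcap_n (if ohead (drop n l) is Some k then B k else setT).
    apply/seteqP; split=> [z Bz n _|z Bz k /= kl].
      case E : ohead => [k|//]; apply: Bz => /=.
      by apply: (@mem_drop n); case: (drop n l) E => //= a s [->]; rewrite mem_head.
    by have := Bz (index k l) Logic.I; rewrite (drop_nth k) ?index_mem//= nth_index.
  by apply: analytic_bigcap => n; case: ohead => // ; exact: analyticT.
have [|C [mC BC RC]] := analytic_separation (aB i) aS.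
  apply/seteqP; split=> // z [Bz [Rz lz]]; apply: (H z Rz) => k.
  by rewrite inE => /orP[/eqP ->//|]; apply: lz.
have [|z [Rz Cz] lz|C' [mC' BC' RC']] := IH (R `&` C).
- by apply: analyticI => //; exact: analytic_measurable.
- by apply: RC Cz; split.
exists (fun k => C' k `&` (if k == i then C else setT)); split.
- by move=> k; apply: measurableI => //; case: ifP.
- by move=> k z Bz; split; [exact: BC'|case: eqP Bz => // -> /BC].
- move=> z Rz Hz; apply: (RC' z).
    by split=> //; have [_] := Hz i (mem_head _ _); rewrite eqxx.
  by move=> k kl; have [] := Hz k; rewrite // inE kl orbT.
Qed.

End separation.

(** Pairs are encoded as bits over a sum of index types, so that the results on analytic subsets of
    [bits J] apply to them. *)
Notation plane := (bits (nat + nat)%type).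
Definition abscissa (z : plane) : bits nat := z \o inl.
Definition ordinate (z : plane) : bits nat := z \o inr.
Definition point_of (x y : bits nat) : plane :=
  fun k => match k with inl n => x n | inr n => y n end.

Lemma abscissa_point_of x y : abscissa (point_of x y) = x.
Proof. by []. Qed.

Lemma ordinate_point_of x y : ordinate (point_of x y) = y.
Proof. by []. Qed.

Lemma plane_ext z z' : abscissa z = abscissa z' -> ordinate z = ordinate z' -> z = z'.
Proof.
move=> e e'; apply/funext => -[] n.
  by have := congr1 (fun f => f n) e.
by have := congr1 (fun f => f n) e'.
Qed.

Lemma analytic_abscissa A : analytic A -> analytic (abscissa @` A).
Proof. exact: analytic_reindex. Qed.

(** The abscissas of points of [A] with bit [k] of the ordinate on, and those with it off, are
    disjoint analytic sets; a Borel set separating them decides bit [k] of a function defined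
    everywhere. *)
Lemma analytic_function_extension (A : set plane) : analytic A ->
  (forall z z', A z -> A z' -> abscissa z = abscissa z' -> ordinate z = ordinate z') ->
  exists2 h : bits nat -> bits nat, measurable_fun setT h &
    forall z, A z -> ordinate z = h (abscissa z).
Proof.
move=> aA funA.
pose P k b := abscissa @` (A `&` [set z : plane | z (inr k) = b]).
have aP k b : analytic (P k b).
  by apply: analytic_abscissa; apply: analyticI => //; exact: analytic_coord.
have /choice[C HC] : forall k, separated (P k true) (P k false).
  move=> k; apply: analytic_separation => //; apply/seteqP; split=> // x.
  move=> [[z [Az zk] <-] [z' [Az' zk'] e]].
  have := congr1 (fun f => f k) (funA _ _ Az Az' (esym e)).
  by rewrite /ordinate /= zk zk'.
exists (fun x k => `[< C k x >]).
  apply: measurable_to_bits => k.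
  rewrite (_ : [set _ | _] = C k); first by have [] := HC k.
  by apply/seteqP; split=> x /= /asboolP.
move=> z Az; apply/funext => k.
have [_ PT PF] := HC k; rewrite /ordinate /=.
case E : (z (inr k)); apply/esym.
  by apply/asboolP/PT; exists z.
by apply/asboolPn/PF; exists z.
Qed.

(** * The Lusin-Novikov theorem *)

Section lusin_novikov.
Variables (D : set (nat -> nat)) (phi : (nat -> nat) -> plane).
Hypotheses (cD : baire_closed D) (cphi : baire_continuous phi).

Let px a := abscissa (phi a).
Let py a := ordinate (phi a).

Let realizes (I : Type) (s : I -> seq nat) (x : bits nat) (a : I -> nat -> nat) :=
  forall i, [/\ D (a i), node (s i) (a i) & px (a i) = x].

(** Only one point of each realization has to lie on a graph: for a single node this captures every
    point, and for several nodes it is what an induction up the tree can carry. *)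
Let small (I : Type) (s : I -> seq nat) :=
  exists2 g : nat -> bits nat -> bits nat, (forall m, measurable_fun setT (g m)) &
    forall x a, realizes s x a -> exists i m, py (a i) = g m x.

Let smallW (I : Type) (s : I -> seq nat) (K : countType)
    (g : K -> bits nat -> bits nat) :
  (forall k, measurable_fun setT (g k)) ->
  (forall x a, realizes s x a -> exists i k, py (a i) = g k x) -> small s.
Proof.
move=> mg H; exists (fun m => if @unpickle K m is Some k then g k else id) => [m|x a].
  by case: unpickle => // ; exact: measurable_id.
by move=> /H[i [k e]]; exists i, (pickle k); rewrite pickleK.
Qed.

(** Proper extension makes the branches converge; disjoint ordinates make different branches yield
    different points. *)
Let splits (I : Type) (s : I -> seq nat) (s' : I * bool -> seq nat) :=
  (forall i b, prefix (s i) (s' (i, b)) /\ (size (s i) < size (s' (i, b)))%N) /\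
  (forall i a b, node (s' (i, false)) a -> node (s' (i, true)) b -> py a <> py b).

Let node_prefix s a n : node s a -> (size s <= n)%N -> prefix s (mkseq a n).
Proof.
move=> sa sn; rewrite (nodeE sa); apply/prefixP.
exists (map a (iota (size s) (n - size s))).
by rewrite /mkseq -map_cat -{1}(add0n (size s)) -iotaD subnKC.
Qed.

(* Outside the union [G] of the graphs given by the splittings, the pieces
   [A i] admit no common abscissa over which all of them have two points; so
   the abscissas can be covered by Borel sets on each of which some piece is
   the graph of a function. *)
Let small_step (I : finType) (s : I -> seq nat) :
  (forall s' : {ffun I * bool -> seq nat}, splits s s' -> small s') -> small s.
Proof.
move=> IH.
have /choice[g Hg] : forall s' : {ffun I * bool -> seq nat},
    exists g : nat -> bits nat -> bits nat, (forall m, measurable_fun setT (g m)) /\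
    (splits s s' -> forall x a, realizes s' x a -> exists i m, py (a i) = g m x).
  move=> s'; have [/IH[g mg Hg]|ns] := pselect (splits s s'); first by exists g.
  by exists (fun=> id); split=> // m; exact: measurable_id.
pose G := [set z : plane | exists k : {ffun I * bool -> seq nat} * nat,
   ordinate z = g k.1 k.2 (abscissa z)].
have mG : measurable G.
  apply: measurable_ex => k; apply: measurable_eq_bits.
    exact: measurable_reindex.
  apply: measurableT_comp; first by have [] := Hg k.1.
  exact: measurable_reindex.
pose A i := phi @` (D `&` node (s i)) `&` ~` G.
have aA i : analytic (A i).
  apply: analyticI; last by apply: analytic_measurable; exact: measurableC.
  exists (D `&` node (s i)), phi; split=> //.
  by apply: baire_closedI => //; exact: node_closed.
(* Abscissas over which [A i] has two points, told apart by bit [k] of the ordinate. *)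
pose B i := \bigcup_k (abscissa @` (A i `&` [set z : plane | z (inr k) = true]) `&`
                       abscissa @` (A i `&` [set z : plane | z (inr k) = false])).
have aB i : analytic (B i).
  apply: analytic_bigcup => k; apply: analyticI; apply: analytic_abscissa;
  by apply: analyticI => //; exact: analytic_coord.
(* Two points of each [A i] over a common abscissa yield, by continuity, a splitting that they
   realize; its functions capture one of them, which then lies in [G]. *)
have B0 x : ~ forall i, B i x.
  move=> Bx.
  have /choice[w Hw] : forall i, exists w : nat * (bool -> nat -> nat), forall b,
      [/\ D (w.2 b), node (s i) (w.2 b), px (w.2 b) = x, ~ G (phi (w.2 b)) &
          phi (w.2 b) (inr w.1) = b].
    move=> i; have [k _ [[_ [[[a1 [D1 s1] <-] G1] /= k1] x1]]] := Bx i.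
    move=> [_ [[[a0 [D0 s0] <-] G0] /= k0] x0].
    by exists (k, fun b : bool => if b then a1 else a0) => -[].
  have /choice[n Hn] : forall ib : I * bool, exists n,
      (size (s ib.1) < n)%N /\ forall c, agree n ((w ib.1).2 ib.2) c ->
        phi c (inr (w ib.1).1) = ib.2.
    move=> [i b] /=; have [_ _ _ _ e] := Hw i b.
    have [n Hn] := cphi (inr (w i).1) ((w i).2 b).
    exists (maxn (size (s i)).+1 n); split; first exact: leq_maxl.
    by move=> c /(agree_leq (leq_maxr _ _)) /Hn ->.
  pose s' := [ffun ib : I * bool => mkseq ((w ib.1).2 ib.2) (n ib)].
  have ss' : splits s s'.
    split=> [i b|i a0 a1]; rewrite /s' !ffunE /=.
      have [ltn _] := Hn (i, b); rewrite size_mkseq; split=> //.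
      by apply: node_prefix; [have [] := Hw i b|exact: ltnW].
    move=> /node_agree h0 /node_agree h1 e.
    have [_ /(_ _ h0)] := Hn (i, false); have [_ /(_ _ h1)] := Hn (i, true).
    have := congr1 (fun f => f (w i).1) e; rewrite /py /ordinate /= => ->.
    by move=> ->.
  have [_ /(_ ss' x (fun ib => (w ib.1).2 ib.2))[|[i b] [m e]]] := Hg s'.
    move=> [i b]; have [? ? ? _ _] := Hw i b; split=> //=.
    by rewrite /s' ffunE; apply/node_agree.
  have [_ _ e' nG _] := Hw i b; apply: nG; exists (s', m).
  by rewrite -/(py _) -/(px _) e'.
have [C [mC BC C0]] := analytic_separation_fin aB B0.
(* Off [C i] no abscissa carries two points of [A i], which is thus a graph there; every abscissa is
   off some [C i]. *)
have /choice[h Hh] : forall i, exists h : bits nat -> bits nat,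
    measurable_fun setT h /\
    forall z, A i z -> ~ C i (abscissa z) -> ordinate z = h (abscissa z).
  move=> i.
  have [|z z' [Az Cz] [Az' Cz'] e|h mh Hh] :=
      @analytic_function_extension (A i `&` [set z | ~ C i (abscissa z)]).
  - apply: analyticI => //; apply: analytic_measurable; apply: measurable_not.
    by apply: measurable_preim (mC i); exact: measurable_reindex.
  - apply/funext => k; apply: contrapT => /eqP neq; apply: Cz; apply: BC.
    exists k => //; rewrite /ordinate /= in neq.
    case E : (z (inr k)) neq; case E' : (z' (inr k)) => // _.
      by split; [exists z|exists z' => //].
    by split; [exists z' => //|exists z].
  - by exists h; split=> // z Az Cz; apply: Hh.
(* Splittings are finite functions into words, hence countably many; one more function per index
   handles the points outside [G]. *)
pose gg (k : ({ffun I * bool -> seq nat} * nat) + I) :=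
  match k with inl k => g k.1 k.2 | inr i => h i end.
apply: (@smallW _ _ (({ffun I * bool -> seq nat} * nat) + I)%type gg) => [[k|i]|x a xa] /=.
- by have [] := Hg k.1.
- by have [] := Hh i.
have [[i [k e]]|nG] := pselect (exists i k, py (a i) = g k.1 k.2 x).
  by exists i, (inl k).
have [i nC] : exists i, ~ C i x by apply/existsNP.
exists i, (inr i) => /=; have [Da na xai] := xa i.
have [_ Hhi] := Hh i; rewrite -xai; apply: Hhi; last by rewrite -/(px _) xai.
split; first by exists (a i).
move=> [k e]; apply: nG; exists i, k.
by rewrite -xai.
Qed.

(** Iterated pairs make the indices of level [n.+1] by definition those of a splitting of level
    [n]. *)
Let index_type := fix index_type n : finType :=
  if n is m.+1 then (index_type m * bool)%type else unit.

Let index_of (b : nat -> bool) := fix index_of n : index_type n :=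
  if n is m.+1 then (index_of m, b m) else tt.

(** If the root were not small, [small_step] would give an infinite sequence of successive
    splittings, none of them small. The limits along binary branches share one abscissa and have
    distinct ordinates, so a section would be uncountable. *)
Lemma countable_sections_functions : (forall x, countable [set y | (phi @` D) (point_of x y)]) ->
  exists2 g : nat -> bits nat -> bits nat, (forall m, measurable_fun setT (g m)) &
    forall z, (phi @` D) z -> exists m, ordinate z = g m (abscissa z).
Proof.
move=> cntF.
have [[g mg Hg]|nsmall] := pselect (small ([ffun=> [::]] : {ffun unit -> seq nat})).
  exists g => // _ [a Da <-].
  have [i|[] [m e]] := Hg (px a) (fun=> a); last by exists m.
  by split=> //; rewrite ffunE.
exfalso.
pose config n := {ffun index_type n -> seq nat}.
have step n (s : {s : config n | ~ small s}) :
    {s' : {s' : config n.+1 | ~ small s'} | splits (sval s) (sval s')}.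
  apply: cid; case: s => s ns /=; apply: contrapT => /forallNP H; apply: ns.
  apply: small_step => s' ss'; apply: contrapT => ns'.
  by apply: (H (exist _ s' ns')).
pose chain := fix chain n : {s : config n | ~ small s} :=
  if n is m.+1 then sval (step m (chain m)) else exist (fun s : config 0 => ~ small s) _ nsmall.
have chainS n : splits (sval (chain n)) (sval (chain n.+1)).
  by rewrite /=; case: (step n _).
pose nd b n := sval (chain n) (index_of b n).
have nd_prefix b n : prefix (nd b n) (nd b n.+1).
  by have [/(_ (index_of b n) (b n))[]] := chainS n.
have nd_size b n : (n <= size (nd b n))%N.
  elim: n => // n IH; apply: leq_ltn_trans IH _.
  by have [/(_ (index_of b n) (b n))[]] := chainS n.
have /choice[br Hbr] : forall b, exists a, forall n, node (nd b n) a.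
  by move=> b; apply: node_limit.
(* A configuration without realizations is vacuously small. *)
have realized n : exists x a, realizes (sval (chain n)) x a.
  have ns := svalP (chain n).
  apply: contrapT => H; apply: ns; exists (fun=> id) => [_|x a xa].
    exact: measurable_id.
  by exfalso; apply: H; exists x, a.
have nd_agree b n c : node (nd b n) c -> agree n (br b) c.
  rewrite (nodeE (Hbr b n)) => /node_agree; apply: agree_leq; exact: nd_size.
have Dbr b : D (br b).
  apply: cD => n; have [x [a xa]] := realized n.
  by have [Da /nd_agree] := xa (index_of b n); exists (a (index_of b n)).
have pxbr b c : px (br b) = px (br c).
  apply/funext => k.
  have [n Hn] := cphi (inl k) (br b); have [m Hm] := cphi (inl k) (br c).
  have [x [a xa]] := realized (maxn n m).
  have [_ /nd_agree ab xb] := xa (index_of b (maxn n m)).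
  have [_ /nd_agree ac xc] := xa (index_of c (maxn n m)).
  rewrite /px /abscissa /= -(Hn _ (agree_leq (leq_maxl _ _) ab)).
  rewrite -(Hm _ (agree_leq (leq_maxr _ _) ac)).
  by have := congr1 (fun f => f k) (etrans xb (esym xc)).
have pyinj b c : py (br b) = py (br c) -> b = c.
  move=> e; apply/funext => k; apply: contrapT => /eqP neq.
  (* The branches part at the first level where [b] and [c] differ, into nodes with disjoint sets of
     ordinates. *)
  have [n bn mn] : exists2 n, b n != c n & forall m, (m < n)%N -> b m = c m.
    have exn : exists n, b n != c n by exists k.
    case: (ex_minnP exn) => n bn mn; exists n => // m mltn.
    by apply/eqP; apply: contraTT mltn => /mn; rewrite -leqNgt.
  have ei : index_of b n = index_of c n.
    elim: n mn {bn} => //= n IH mn; rewrite mn// IH// => m mn'.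
    by apply: mn; exact: ltnW.
  have [_ /(_ (index_of b n))] := chainS n.
  have := Hbr b n.+1; have := Hbr c n.+1; rewrite /nd /= -ei.
  by case: (b n) bn; case: (c n) => //= _ h1 h2 /(_ (br _) (br _)) H;
    [apply: (H _ _ h1 h2)|apply: (H _ _ h2 h1)].
pose x := px (br (fun=> false)).
have cnt : countable (range (fun b => py (br b))).
  apply: sub_countable (cntF x); apply: subset_card_le => _ [b _ <-] /=.
  exists (br b) => //; apply: plane_ext => //.
  by rewrite abscissa_point_of -/(px _) (pxbr b (fun=> false)).
have /countable_injP[f finj] := cnt.
pose h b := f (py (br b)).
have hinj b c : h b = h c -> b = c.
  by move=> e; apply: pyinj; apply: finj e; rewrite inE; [exists b|exists c].
(* Cantor's diagonal argument against the injection [h] of [nat -> bool] into [nat]. *)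
pose d n := ~~ `[< exists2 b, h b = n & b n >].
have : d (h d) = ~~ d (h d).
  rewrite {1}/d; congr (~~ _); apply/asboolP/idP => [[b /hinj ->]//|dd].
  by exists d.
by case: (d _).
Qed.

End lusin_novikov.

(** Borel functions cover the graph of [F]; where one of them leaves the class of [x], its value is
    replaced by [x], a Borel change since [F] is Borel. *)
Lemma countable_equivalence_functions (F : bits nat -> bits nat -> Prop) :
  countable_borel_equivalence F ->
  exists2 f : nat -> bits nat -> bits nat, (forall m, measurable_fun setT (f m)) &
    forall x y, F x y <-> exists m, y = f m x.
Proof.
move=> [[Frefl Fsym _] mF cF].
pose S := [set z : plane | F (abscissa z) (ordinate z)].
have mS : measurable S.
  apply: (@measurable_preim _ _ _ _ (fun z => (abscissa z, ordinate z)) _ _ mF).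
  by apply: measurable_fun_pair; exact: measurable_reindex.
have [D [phi [cD cphi SE]]] := analytic_measurable mS.
have [|g mg Hg] := countable_sections_functions cD cphi.
  move=> x; apply: sub_countable (cF x); apply: subset_card_le => y xy.
  by apply: Fsym; have : S (point_of x y) by rewrite SE.
exists (fun m x => if `[< F x (g m x) >] then g m x else x) => [m|x y].
  apply: measurable_to_bits => j.
  rewrite (_ : [set _ | _] = [set x | (F x (g m x) /\ g m x j) \/
                                     (~ F x (g m x) /\ x j)]); last first.
    by apply/seteqP; split=> x /=; case: asboolP; tauto.
  have mFg : measurable [set x | F x (g m x)].
    apply: (@measurable_preim _ _ _ _ (fun x => (x, g m x)) _ _ mF).
    by apply: measurable_fun_pair => //; exact: measurable_id.
  apply: measurable_disj; apply: measurable_conj => //.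
  - by apply: measurable_coord; exact: mg.
  - exact: measurable_not.
  - by apply: (@measurable_coord _ _ _ id); exact: measurable_id.
split=> [Fxy|[m ->]]; last by case: asboolP => // _; exact: Frefl.
have [|m] := Hg (point_of x y); first by rewrite -SE.
rewrite ordinate_point_of abscissa_point_of => e; exists m.
by rewrite -e; case: asboolP.
Qed.

(** * Codes for standard Borel spaces *)

Section polish_code.
Local Open Scope ring_scope.
Variables (R : realType) (M : metricType R).
Hypothesis cM : complete_metric M.
Variable q : nat -> M.
Hypothesis dq : dense (range q).

Definition radius (k : nat) : R := k.+1%:R^-1.

Lemma radius_gt0 k : 0 < radius k.
Proof. by rewrite invr_gt0. Qed.

Lemma radius_lt (e : R) : 0 < e -> exists k, radius k < e.
Proof.
move=> e0; exists (Num.truncn e^-1); rewrite /radius invf_plt ?posrE//.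
exact: truncnS_gt.
Qed.

Lemma dense_approx x (e : R) : 0 < e -> exists i, mdist (q i) x < e.
Proof.
move=> e0.
have [y [xy [i _ iy]]] : (ball x e)° `&` range q !=set0.
  apply: dq; last exact: open_interior.
  exists x; exact: nbhsx_ballx.
exists i; rewrite iy metric_sym.
by have := interior_subset xy; rewrite ballEmdist.
Qed.

(** Numbers that code no pair are read as [(0, 0)]; the first clause of [is_polish_code] accounts
    for this repetition. *)
Definition pair_of (n : nat) : nat * nat := odflt (0%N, 0%N) (unpickle n).

Lemma pair_ofK p : pair_of (pickle p) = p.
Proof. by rewrite /pair_of pickleK. Qed.

Definition basic_ball (p : nat * nat) := [set x : M | mdist (q p.1) x < radius p.2].

Definition polish_code (x : M) : bits nat := fun n => `[< basic_ball (pair_of n) x >].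

Lemma polish_codeP x p : polish_code x (pickle p) <-> basic_ball p x.
Proof. by rewrite /polish_code pair_ofK; split => /asboolP. Qed.

(* The codes of points of [M] are the ideals of basic balls containing balls of
   every radius; completeness of [M] makes each such ideal a point. *)
Definition is_polish_code (c : bits nat) :=
  [/\ forall n, c n <-> c (pickle (pair_of n)),
      forall k : nat, exists i : nat, c (pickle (i, k)),
      forall p r : nat * nat, ~ (c (pickle p) /\ c (pickle r) /\
                     radius p.2 + radius r.2 <= mdist (q p.1) (q r.1)) &
      forall p : nat * nat, c (pickle p) <-> exists r : nat * nat, c (pickle r) /\
                     mdist (q p.1) (q r.1) + radius r.2 < radius p.2].

Lemma is_polish_code_polish_code x : is_polish_code (polish_code x).
Proof.
split.
- by move=> n; rewrite /polish_code pair_ofK.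
- by move=> k; have [i ix] := dense_approx x (radius_gt0 k); exists i; apply/polish_codeP.
- move=> p r [/polish_codeP px [/polish_codeP rx]].
  rewrite leNgt => /negP; apply.
  have := metric_triangle (q p.1) x (q r.1); rewrite (metric_sym x).
  by move: px rx; rewrite /basic_ball /=; lra.
- move=> p; split=> [/polish_codeP px|[r [/polish_codeP]]].
    have e0 : 0 < (radius p.2 - mdist (q p.1) x) / 2.
      by move: px; rewrite /basic_ball /=; lra.
    have [k ke] := radius_lt e0.
    have [i ix] := dense_approx x (radius_gt0 k).
    exists (i, k); split; first exact/polish_codeP.
    have := metric_triangle (q p.1) x (q i); rewrite (metric_sym x) /=.
    by move: px ix ke; rewrite /basic_ball /=; lra.
  rewrite polish_codeP /basic_ball /= => rx pr.
  have := metric_triangle (q p.1) (q r.1) x; lra.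
Qed.

(** Centres of balls of the code, one per radius, form a Cauchy sequence by the third clause. Its
    limit lies in the closure of each condition, and the last clause, which puts a smaller ball
    strictly inside, restores the strict inequality. *)
Lemma is_polish_code_surj c : is_polish_code c -> exists x, polish_code x = c.
Proof.
move=> [c0 /choice[i ci] c2 c3].
pose u k := q (i k).
have cu : cauchy (u @ \oo).
  apply: cauchy_exP => e e0.
  (* Later centres are within [2 * radius k] of [u k]. *)
  have [k ke] : exists k, radius k < e / 2 by apply: radius_lt; lra.
  exists (u k); exists k => // m /= km; rewrite ballEmdist /=.
  rewrite ltNge; apply/negP => H.
  apply: (c2 (i k, k) (i m, m)); do 2!split => //=; apply: le_trans H.
  have : radius m <= radius k by rewrite lef_pV2 ?posrE// ler_nat.
  by move: ke; lra.
have [x ux] := cM cu.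
have cball (p : nat * nat) : c (pickle p) -> mdist (q p.1) x <= radius p.2.
  move=> cp; apply/ler_addgt0Pr => e e0.
  have e20 : 0 < e / 2 by lra.
  have [k ke] := radius_lt e20.
  have /metricType_numDomainType.cvgrPdist_lt/(_ _ e20)[N _ HN] := ux.
  have /= := HN (maxn N k) (leq_maxl _ _); rewrite metric_sym => Nx.
  have rk : radius (maxn N k) <= radius k.
    by rewrite lef_pV2 ?posrE// ler_nat ltnS leq_maxr.
  have := c2 p (i (maxn N k), maxn N k) => H.
  have {H} : mdist (q p.1) (u (maxn N k)) < radius p.2 + radius (maxn N k).
    by rewrite ltNge; apply/negP => H'; apply: H.
  have := metric_triangle (q p.1) (u (maxn N k)) x; lra.
exists x; apply/funext => n.
suff H (p : nat * nat) : polish_code x (pickle p) <-> c (pickle p).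
  apply/idP/idP => [h|/c0 /H /polish_codeP h]; last exact/asboolP.
  by apply/c0/H/polish_codeP; apply/asboolP.
rewrite polish_codeP /basic_ball /=; split=> [px|/c3[r [/cball rx pr]]]; last first.
  have := metric_triangle (q p.1) (q r.1) x; lra.
apply/c3.
have e0 : 0 < (radius p.2 - mdist (q p.1) x) / 2 by lra.
have [k ke] := radius_lt e0.
exists (i k, k); split=> //=.
have := cball _ (ci k); have := metric_triangle (q p.1) x (q (i k)).
rewrite (metric_sym x) /=; lra.
Qed.

Lemma polish_code_inj x y : polish_code x = polish_code y -> x = y.
Proof.
move=> e; apply/eqP; apply: contrapT => /negP; rewrite -mdist_gt0 => xy0.
have e0 : 0 < mdist x y / 2 by lra.
have [k ke] := radius_lt e0.
have [i ix] := dense_approx x (radius_gt0 k).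
have /polish_codeP iy : polish_code y (pickle (i, k)).
  by rewrite -e; apply/polish_codeP.
have := metric_triangle x (q i) y; rewrite (metric_sym x (q i)).
by move: iy; rewrite /basic_ball /=; lra.
Qed.

Lemma measurable_is_polish_code : measurable [set c | is_polish_code c].
Proof.
have mc n : measurable [set c : bits nat | c n] by exact: measurable_coord_eq.
rewrite (_ : [set _ | _] =
  [set c : bits nat | (forall n, c n <-> c (pickle (pair_of n))) /\
      ((forall k : nat, exists i : nat, c (pickle (i, k))) /\
      ((forall p r : nat * nat, ~ (c (pickle p) /\ (c (pickle r) /\
                     radius p.2 + radius r.2 <= mdist (q p.1) (q r.1)))) /\
      (forall p : nat * nat, c (pickle p) <-> exists r : nat * nat, c (pickle r) /\
                     mdist (q p.1) (q r.1) + radius r.2 < radius p.2)))]).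
  apply: measurable_conj; first by apply: measurable_all => n; exact: measurable_iff.
  apply: measurable_conj.
    by apply: measurable_all => k; exact: measurable_ex.
  apply: measurable_conj.
    apply: measurable_all => p; apply: measurable_all => r; apply: measurable_not.
    by do 2!apply: measurable_conj => //; exact: measurable_cstP.
  apply: measurable_all => p; apply: measurable_iff => //.
  by apply: measurable_ex => r; apply: measurable_conj => //; exact: measurable_cstP.
by apply/seteqP; split=> [c /= [? ? ? ?]|c /= [? [? [? ?]]]].
Qed.

Lemma open_basic_ball p : open (basic_ball p).
Proof.
rewrite openE => x px; rewrite /interior.
have e0 : 0 < radius p.2 - mdist (q p.1) x by move: px; rewrite /basic_ball/=; lra.
apply/nbhs_ballP; exists (radius p.2 - mdist (q p.1) x) => //= y.
rewrite ballEmdist /basic_ball /=.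
have := metric_triangle (q p.1) x y; lra.
Qed.

Lemma open_bigcup_basic_ball (U : set M) : open U ->
  U = \bigcup_(p in [set p | basic_ball p `<=` U]) basic_ball p.
Proof.
move=> oU; apply/seteqP; split=> [x Ux|x [p pU] /pU//].
have /nbhs_ballP[e /= e0 eU] := open_nbhs_nbhs (conj oU Ux).
have e20 : 0 < e / 2 by lra.
have [k ke] := radius_lt e20.
have [i ix] := dense_approx x (radius_gt0 k).
exists (i, k) => // y; rewrite /basic_ball /= => iy.
apply: eU; rewrite ballEmdist /=.
have := metric_triangle x (q i) y; rewrite (metric_sym x (q i)); lra.
Qed.

End polish_code.

(** Codes make [Y] a Borel retract of [bits nat], to which equivalence relations can then be
    transported. What is not a code is sent to [point]. *)
Lemma standard_borel_code (R : realType) d (Y : measurableType d) :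
  standard_borel R Y -> exists (e : Y -> bits nat) (r : bits nat -> Y),
    [/\ measurable_fun setT e, measurable_fun setT r & cancel e r].
Proof.
move=> [M [f [cM [D cD dD] [g fK gK] mf]]].
have [q qD] : exists q : nat -> M, D `<=` range q.
  have /pfcard_geP[D0|[q]] : (D #<= [set: nat])%card by exact: cD.
    have [||x [_]] := dD setT; last by rewrite D0.
      by exists (f point).
    exact: openT.
  exists q; exact: surj.
have dq : dense (range q).
  move=> O O0 oO; have [x [Ox Dx]] := dD _ O0 oO.
  by exists x; split=> //; exact: qD.
pose e y := polish_code q (f y).
have einj : injective e by move=> x y /(polish_code_inj dq)/(can_inj fK).
pose r c := xget point [set y | e y = c].
have rK c : is_polish_code q c -> e (r c) = c.
  move=> /(is_polish_code_surj cM)[x xc]; rewrite /r.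
  by apply: (@xgetPex _ point [set y | e y = c]); exists (g x); rewrite /= /e gK.
have ecode y : is_polish_code q (e y) by exact: is_polish_code_polish_code.
have ner c : ~ is_polish_code q c -> r c = point.
  move=> nc; rewrite /r xgetPN// => y /= yc; apply: nc.
  by rewrite -yc.
exists e, r; split; last by move=> y; apply: einj; rewrite rK.
  apply: measurable_to_bits => n.
  rewrite (_ : [set _ | _] = f @^-1` basic_ball q (pair_of n)).
    apply/mf; apply: sub_sigma_algebra; exact: open_basic_ball.
  by apply/seteqP; split=> y /= /asboolP.
(* The sets with Borel preimage form a sigma-algebra containing the basic balls, hence also the open
   sets, which are countable unions of these. *)
pose good := [set B : set M | measurable (r @^-1` (f @^-1` B))].
have gball p : good (basic_ball q p).
  rewrite /good /=.
  rewrite (_ : _ @^-1` _ = [set c | (is_polish_code q c /\ c (pickle p)) \/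
     (~ is_polish_code q c /\ basic_ball q p (f point))]).
    have mc := measurable_is_polish_code q.
    apply: measurable_disj; apply: measurable_conj => //.
    - exact: measurable_coord_eq.
    - exact: measurable_not.
    - exact: measurable_cstP.
  apply/seteqP; split=> c /=; have [cc|nc] := pselect (is_polish_code q c).
  - by move=> h; left; split=> //; rewrite -(rK _ cc); apply/polish_codeP.
  - by move=> h; right; split=> //; rewrite -(ner _ nc).
  - by case=> -[// _]; rewrite -{1}(rK _ cc) => /polish_codeP.
  - by case=> -[// _]; rewrite (ner _ nc).
have gsigma : <<s @open M >> `<=` good.
  apply: smallest_sub.
    split; first exact: measurable0.
    - by move=> B gB; rewrite setTD; exact: (measurableC gB).
    - by move=> F gF; exact: (bigcupT_measurable _ gF).
  move=> U oU; rewrite (open_bigcup_basic_ball dq oU) /good /=.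
  rewrite (_ : _ @^-1` _ = [set c | exists p,
      basic_ball q p `<=` U /\ basic_ball q p (f (r c))]).
    apply: measurable_ex => p; apply: measurable_conj; first exact: measurable_cstP.
    exact: gball.
  by apply/seteqP; split=> [c /= [p pU pc]|c /= [p [pU pc]]]; exists p.
move=> _ B mB; rewrite setTI.
have -> : r @^-1` B = r @^-1` (f @^-1` (g @^-1` B)).
  by apply/seteqP; split=> c /=; rewrite fK.
apply: gsigma; apply/mf; rewrite (_ : _ @^-1` _ = B)//.
by apply/seteqP; split=> y /=; rewrite fK.
Qed.

(** * A complete metric on products of two-point spaces *)

Section bits_metric.
Local Open Scope ring_scope.
Variables (R : realType) (J : countType).
Implicit Types x y z : bits J.

Definition eq_below n x y := forall j, (pickle j < n)%N -> x j = y j.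

Definition differ_at x y n := `[< exists2 j, pickle j = n & x j != y j >].

(** The standard ultrametric of Cantor space: only the first difference counts, in the order of
    [pickle]. *)
Definition bits_dist x y : R :=
  if pselect (exists n, differ_at x y n) is left h then radius R (ex_minn h) else 0.

Lemma radius_le m n : (radius R m <= radius R n) = (n <= m)%N.
Proof. by rewrite /radius lef_pV2 ?posrE// ler_nat. Qed.

Lemma bits_distP x y n : bits_dist x y <= radius R n <-> eq_below n x y.
Proof.
rewrite /bits_dist; case: pselect => [h|nh].
  case: ex_minnP => m /asboolP[j jm xyj] minm; rewrite radius_le; split=> [nm k kn|H].
    apply: contrapT => /eqP xyk; have := minm (pickle k); rewrite leqNgt.
    by rewrite (leq_trans kn nm) => /(_ _)/negP; case=> //; apply/asboolP; exists k.
  by rewrite leqNgt -jm; apply/negP => /H/eqP; rewrite (negbTE xyj).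
split=> [_ j _|_]; last by rewrite ltW// radius_gt0.
apply: contrapT => /eqP xyj; apply: nh; exists (pickle j); apply/asboolP.
by exists j.
Qed.

Lemma bits_dist_value x y : x = y \/ exists n, bits_dist x y = radius R n.
Proof.
have [h|nh] := pselect (exists n, differ_at x y n).
  by right; rewrite /bits_dist; case: pselect => // h'; exists (ex_minn h').
left; apply/funext => j; apply: contrapT => /eqP xyj; apply: nh.
by exists (pickle j); apply/asboolP; exists j.
Qed.

Lemma bits_distxx x : bits_dist x x = 0.
Proof.
rewrite /bits_dist; case: pselect => // h; exfalso.
by case: h => n /asboolP[j _]; rewrite eqxx.
Qed.

Lemma bits_dist_eq0 x y : bits_dist x y = 0 -> x = y.
Proof.
case: (bits_dist_value x y) => // -[n ->] /eqP.
by rewrite gt_eqF// radius_gt0.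
Qed.

Lemma eq_below_sym n x y : eq_below n x y -> eq_below n y x.
Proof. by move=> xy j /xy. Qed.

Lemma bits_dist_sym x y : bits_dist x y = bits_dist y x.
Proof.
wlog suff H : x y / bits_dist x y <= bits_dist y x.
  by apply/eqP; rewrite eq_le !H.
have [->//|[n e]] := bits_dist_value y x.
by rewrite e; apply/bits_distP/eq_below_sym/bits_distP; rewrite e.
Qed.

Lemma bits_dist_triangle y x z : bits_dist x z <= bits_dist x y + bits_dist y z.
Proof.
have [->|[n en]] := bits_dist_value x y; first by rewrite bits_distxx add0r.
have [->|[m em]] := bits_dist_value y z; first by rewrite bits_distxx addr0.
(* The ultrametric inequality: [x] and [z] agree as far as the shorter of the two agreements. *)
apply: (@le_trans _ _ (radius R (minn n m))).
  apply/bits_distP => j; rewrite leq_min => /andP[jn jm].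
  have /bits_distP -> // : bits_dist x y <= radius R n by rewrite en.
  by have /bits_distP -> // : bits_dist y z <= radius R m by rewrite em.
rewrite en em; have := radius_gt0 R n; have := radius_gt0 R m.
by case: (leqP n m) => _; lra.
Qed.

End bits_metric.

(* A copy of [bits J]: the metric depends on [R], which the type [bits J] does
   not determine. *)
Definition metric_bits (R : realType) (J : countType) : Type := bits J.
HB.instance Definition _ R J := Choice.on (metric_bits R J).
HB.instance Definition _ (R : realType) J := @isMetric.Build R (metric_bits R J)
  (@bits_dist R J) (@bits_distxx R J) (@bits_dist_eq0 R J) (@bits_dist_sym R J)
  (@bits_dist_triangle R J).

Section bits_polish.
Variables (R : realType) (J : countType).
Local Notation M := (metric_bits R J).

Lemma metric_bits_ball (x : M) n y : ball x (radius R n) y -> eq_below n x y.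
Proof. by rewrite ballEmdist /= => /ltW /bits_distP. Qed.

Lemma metric_bits_nbhs (x : M) (U : set M) :
  nbhs x U <-> exists n, forall y, eq_below n x y -> U y.
Proof.
split=> [/nbhs_ballP[e /= e0 eU]|[n H]].
  have [n ne] := radius_lt e0; exists n => y /(bits_distP R) xy.
  by apply: eU; rewrite ballEmdist /=; exact: le_lt_trans ne.
apply/nbhs_ballP; exists (radius R n); first exact: radius_gt0.
by move=> y /metric_bits_ball /H.
Qed.

Definition finite_bits (l : seq J) : M := fun j => j \in l.

Lemma finite_bits_approx (x : M) n : exists l, eq_below n x (finite_bits l).
Proof.
exists [seq j <- pmap (@unpickle J) (iota 0 n) | x j] => j jn.
rewrite /finite_bits mem_filter mem_pmap.
case: (x j) => //=; apply/esym/mapP; exists (pickle j); last by rewrite pickleK.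
by rewrite mem_iota.
Qed.

Lemma complete_metric_bits : complete_metric M.
Proof.
move=> u /cauchy_ballP cu.
have /choice[N HN] : forall n, exists N, forall m, (N <= m)%N -> eq_below n (u N) (u m).
  move=> n; have [[A B] /= [[N1 _ A1] [N2 _ B2]] AB] := cu _ (radius_gt0 R n).
  exists (maxn N1 N2) => m Nm; apply: metric_bits_ball; apply: (AB (_, _)); split=> /=.
    by apply: A1; exact: leq_maxl.
  by apply: B2; apply: leq_trans Nm; exact: leq_maxr.
(* Bit [j] no longer changes from stage [N (pickle j).+1] on. *)
exists (fun j => u (N (pickle j).+1) j) => U /metric_bits_nbhs[n HU].
exists (\max_(k < n.+1) N k) => // m /= Nm; apply: HU => j jn.
apply: HN => //; apply: leq_trans Nm.
have jn' : ((pickle j).+1 < n.+1)%N by [].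
exact: (leq_bigmax (Ordinal jn')).
Qed.

Lemma separable_metric_bits : separable M.
Proof.
exists (range finite_bits).
  apply: sub_countable (countableP (@setT (seq J))); exact: card_image_le.
move=> U [x Ux] oU.
have /metric_bits_nbhs[n HU] := open_nbhs_nbhs (conj oU Ux).
have [l xl] := finite_bits_approx x n.
by exists (finite_bits l); split; [exact: HU|exists l].
Qed.

Lemma measurable_bits_borel (B : set M) :
  @measurable _ (bits J) B <-> <<s @open M >> B.
Proof.
split; apply: smallest_sub; do ?exact: smallest_sigma_algebra.
  move=> _ [j _ <-]; apply: sub_sigma_algebra => /=.
  rewrite openE => x xj; apply/metric_bits_nbhs; exists (pickle j).+1 => y.
  by move=> /(_ j (leqnn _)) e; rewrite /= -e.
move=> U oU.
(* [U] is the countable union of the cylinders it contains around points of finite support. *)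
rewrite (_ : U = [set x : bits J | exists nl : nat * seq J,
   (forall j, ((pickle j < nl.1)%N -> x j = finite_bits nl.2 j)) /\
   (forall y, eq_below nl.1 (finite_bits nl.2) y -> U y)]).
  apply: (@measurable_ex _ (bits J)) => -[n l]; apply: (@measurable_conj _ (bits J)).
    apply: (@measurable_all _ (bits J)) => j /=.
    have [jn|jn] := boolP (pickle j < n)%N.
      rewrite (_ : [set _ | _] = [set x : bits J | x j = finite_bits l j]).
        exact: measurable_coord_eq.
      by apply/seteqP; split=> x /= H; [exact: H|].
    rewrite (_ : [set _ | _] = setT); first exact: measurableT.
    by apply/seteqP; split.
  exact: measurable_cstP.
apply/seteqP; split=> [x Ux|x [[n l] /= [xl H]]]; last first.
  by apply: H; apply: eq_below_sym.
have /metric_bits_nbhs[n HU] := open_nbhs_nbhs (conj oU Ux).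
have [l xl] := finite_bits_approx x n.
exists (n, l); split=> //= y ly; apply: HU => j jn.
by rewrite xl// ly.
Qed.

Lemma standard_borel_bits : standard_borel R (bits J).
Proof.
exists M, id; split.
- exact: complete_metric_bits.
- exact: separable_metric_bits.
- by exists id.
- exact: measurable_bits_borel.
Qed.

End bits_polish.

(** * Crowns *)

Definition cyc (N i : nat) := if i.+1 == N then 0 else i.+1.

Lemma iter_cyc N x k : (x < N)%N -> (k <= N)%N ->
  iter k (cyc N) x = if (x + k < N)%N then x + k else x + k - N.
Proof.
move=> xN; elim: k => [|k IH] kN; first by rewrite addn0 xN.
rewrite iterS (IH (ltnW kN)) /cyc.
by case: (ltnP (x + k) N) => h; case: (ltnP (x + k.+1) N) => h'; case: eqP; lia.
Qed.

Lemma iter_cyc_lt N i : (0 < N)%N -> (iter i (cyc N) 0 < N)%N.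
Proof. move=> N0; elim: i => //= i; move: (iter i _ _) => k kN.
by rewrite /cyc; case: eqP; lia. Qed.

(* A closed walk around a cycle of length [N] that never turns back, mapped
   injectively into a cycle of length [M], cannot turn back either. *)
Lemma crown_walk N M (a b : nat -> nat) : (1 < N)%N -> (1 < M)%N ->
  (forall i, a i < M)%N ->
  (forall i, b i = a i \/ b i = cyc M (a i)) ->
  (forall i, b i.+1 = a i \/ b i.+1 = cyc M (a i)) ->
  (forall i, a i <> a i.+1) -> (forall i, b i <> b i.+1) ->
  a N = a 0 -> {in gtn N &, injective a} -> N = M.
Proof.
move=> N1 M1 aM ba bSa naS nbS aN ainj.
have NM : (N <= M)%N.
  have finj : injective (fun i : 'I_N => Ordinal (aM i)).
    by move=> i j /(congr1 val)/= /ainj e; apply/val_inj/e; rewrite inE /=.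
  by have := leq_card _ finj; rewrite !card_ord.
(* A rotation of the [M]-cycle by [N] steps, with [0 < N <= M], fixes a point only if [N = M]. *)
suff iN : exists2 x, (x < M)%N & iter N (cyc M) x = x.
  have [x xM] := iN; rewrite iter_cyc//; case: ltnP; lia.
(* The first vertex fixes the sense of rotation: forward throughout if [b 0 = a 0], backward
   throughout otherwise. *)
case: (ba 0) => b0.
  suff H i : a i = iter i (cyc M) (a 0) /\ b i = a i.
    by exists (a 0) => //; have [<- _] := H N.
  elim: i => [|i [IHa IHb]] //=.
  have bS : b i.+1 = cyc M (a i).
    by case: (bSa i) => // e; have := nbS i; rewrite e IHb.
  have aS : a i.+1 = cyc M (a i).
    case: (ba i.+1) => [<-//|e]; have := naS i; move: e; rewrite bS.
    have := aM i; have := aM i.+1.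
    by rewrite /cyc; case: eqP; case: eqP; lia.
  by rewrite bS aS -IHa.
suff H i : iter i (cyc M) (a i) = a 0 /\ b i = cyc M (a i).
  by exists (a N) => //; have [-> _] := H N.
elim: i => [|i [IHa IHb]] //.
have bS : b i.+1 = a i.
  by case: (bSa i) => // e; have := nbS i; rewrite e IHb.
have aS : cyc M (a i.+1) = a i.
  by case: (ba i.+1) => [e|<-//]; have := naS i; rewrite -bS e.
by rewrite iterSr aS bS.
Qed.

(* The vertex [(m, (i, b))] lies in the [m]-th crown, the bipartite order on
   two copies of the cycle of length [m + 2]; it is maximal iff [b]. *)
Notation vertex := (nat * (nat * bool))%type.

Definition crown_lt (s : nat -> bool) (u v : vertex) :=
  [/\ u.1 = v.1 /\ s u.1, u.2.2 = false /\ v.2.2 = true,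
      (u.2.1 < u.1.+2)%N /\ (v.2.1 < u.1.+2)%N &
      v.2.1 = u.2.1 \/ v.2.1 = cyc u.1.+2 u.2.1].

(** Comparable vertices lie in the same crown, so the image walk stays in one crown of [t]; by
    [crown_walk] its length is [m.+2], so it is the [m]-th one. Positions taken through [iter] turn
    the closed walk into a periodic infinite one. *)
Lemma crown_embedding (t : nat -> bool) m (al be : nat -> vertex) :
  (forall i, crown_lt t (al i) (be i) /\ crown_lt t (al i) (be i.+1)) ->
  (forall i j, al i = al j -> iter i (cyc m.+2) 0 = iter j (cyc m.+2) 0) ->
  (forall i j, iter i (cyc m.+2) 0 = iter j (cyc m.+2) 0 -> al i = al j) ->
  (forall i j, be i = be j -> iter i (cyc m.+2) 0 = iter j (cyc m.+2) 0) ->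
  t m.
Proof.
move=> H ainj aeq binj.
have alS i : (al i).1 = (al 0).1.
  elim: i => // i <-; have [_ [[e _] _ _ _]] := H i.
  by have [[[e' _] _ _ _] _] := H i.+1; rewrite e' -e.
have alb i : (al i).2.2 = false by have [[_ [-> _]]] := H i.
have alE i : al i = ((al 0).1, ((al i).2.1, false)).
  by rewrite -(alb i) -(alS i); case: (al i) => [? []].
have beE i : be i = ((al 0).1, ((be i).2.1, true)).
  have [[[e _] [_ eb] _ _] _] := H i.
  by rewrite -(alS i) e -eb; case: (be i) => [? []].
have neqS i : iter i (cyc m.+2) 0 <> iter i.+1 (cyc m.+2) 0.
  by rewrite iterS; move: (iter i _ _) => k; rewrite /cyc; case: eqP; lia.
have e : m.+2 = (al 0).1.+2.
  apply: (@crown_walk _ _ (fun i => (al i).2.1) (fun i => (be i).2.1)) => //.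
  - by move=> i; have [[_ _ [+ _] _] _] := H i; rewrite (alS i).
  - by move=> i; have [[_ _ _ +] _] := H i; rewrite (alS i).
  - by move=> i; have [_ [_ _ _ +]] := H i; rewrite (alS i).
  - by move=> i e; apply: (neqS i); apply: ainj; rewrite alE e -alE.
  - by move=> i e; apply: (neqS i); apply: binj; rewrite beE e -beE.
  - by congr (_.2.1); apply: aeq; rewrite iter_cyc//= add0n ltnn subnn.
  - move=> i j; rewrite !inE /= => iN jN e.
    have /ainj : al i = al j by rewrite alE e -alE.
    have iterE k : (k < m.+2)%N -> iter k (cyc m.+2) 0 = k.
      by move=> kN; rewrite iter_cyc ?add0n ?kN// ltnW.
    by rewrite !iterE.
have [[[_ +] _ _ _] _] := H 0.
by case: e => <-.
Qed.

(** * The quasi-orders *)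

(** [Some (w, n)] holds bit [n] of the point attached to the word [w]; [None] holds a flag. *)
Notation ambient := (bits (option (seq nat * nat)%type)).

Definition shift_index (w : seq nat) (k : option (seq nat * nat)) :=
  if k is Some (v, n) then Some (w ++ v, n) else None.

Definition shift w (x : ambient) : ambient := x \o shift_index w.

Lemma shift_cat v w x : shift v (shift w x) = shift (w ++ v) x.
Proof. by apply/funext => -[[u n]|] //=; rewrite /shift /= catA. Qed.

(* The coordinate [None] separates the words, on which the free monoid acts by
   shifts, from the room left for the crowns. *)
Definition shift_equiv (x y : ambient) :=
  x = y \/ [/\ x None, exists w, y = shift w x & exists v, x = shift v y].

Lemma shift_equiv_equivalence : Equivalence shift_equiv.
Proof.
split=> [x|x y|x y z]; first by left.
- by case=> [->|[x0 [w e] H]]; [left|right; split=> //; [rewrite e|exists w]].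
- case=> [->//|[x0 [w ew] [v ev]]] [<-|[_ [w' ew'] [v' ev']]]; right; split=> //.
  + by exists w.
  + by exists v.
  + by exists (w ++ w'); rewrite -shift_cat -ew.
  + by exists (v' ++ v); rewrite -shift_cat -ev'.
Qed.

Lemma measurable_shift_equiv : borel_relation shift_equiv.
Proof.
have m1 : measurable_fun setT (fst : ambient * ambient -> ambient) by exact: measurable_fst.
have m2 : measurable_fun setT (snd : ambient * ambient -> ambient) by exact: measurable_snd.
rewrite /borel_relation (_ : [set _ | _] = [set p : ambient * ambient |
  p.1 = p.2 \/ (p.1 None /\ ((exists w, p.2 = shift w p.1) /\
    (exists v, p.1 = shift v p.2)))]); last first.
  by apply/seteqP; split=> p /= [->|]; [left|case=> ? ? ?; right|left|case=> ? [? ?]; right].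
have ms w : measurable_fun setT (shift w) by exact: measurable_reindex.
apply: measurable_disj; first exact: measurable_eq_bits.
apply: measurable_conj; first exact: measurable_coord.
by apply: measurable_conj; apply: measurable_ex => w; apply: measurable_eq_bits => //;
  exact: measurableT_comp.
Qed.

(** With the flag off, this point is equivalent only to itself; its single bit, at the empty word,
    identifies the vertex. *)
Definition crown_point (u : vertex) : ambient := fun k =>
  if k is Some (v, n) then (v == [::]) && (n == pickle u) else false.

Lemma crown_point_inj : injective crown_point.
Proof.
move=> u v /(congr1 (fun f => f (Some ([::], pickle u)))) /=.
by rewrite eqxx => /esym/eqP/(pcan_inj pickleK).
Qed.

Definition crown_order s (x y : ambient) := shift_equiv x y \/
  exists u v, [/\ crown_lt s u v, x = crown_point u & y = crown_point v].

Lemma shift_equiv_crown_point u y : shift_equiv (crown_point u) y -> crown_point u = y.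
Proof. by case=> // -[]. Qed.

Lemma shift_equiv_sym x y : shift_equiv x y -> shift_equiv y x.
Proof. by have [_ S _] := shift_equiv_equivalence; exact: S. Qed.

Lemma crown_lt_asym s u v w : crown_lt s u v -> ~ crown_lt s v w.
Proof. by move=> [_ [_ e] _ _] [_ [e' _] _ _]; rewrite e in e'. Qed.

(** Crowns have two levels, so strict comparisons are never reversed and adding crowns leaves the
    equivalence unchanged. Universality is thus needed for one relation only. *)
Lemma assoc_crown_order s : assoc_equiv (crown_order s) = shift_equiv.
Proof.
apply/funext => x; apply/funext => y; apply/propext; split=> [[]|xy]; last first.
  by split; left=> //; exact: shift_equiv_sym.
move=> [//|[u [v [uv -> ->]]]] [|[v' [w [vw /crown_point_inj e _]]]].
  exact: shift_equiv_sym.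
by move: vw; rewrite -e => /(crown_lt_asym uv).
Qed.

(** No two strict comparisons compose, and vertices are alone in their classes, so no new comparison
    arises. *)
Lemma crown_order_preorder s : PreOrder (crown_order s).
Proof.
have [Er Es Et] := shift_equiv_equivalence.
split=> [x|x y z]; first by left.
case=> [xy|[u [v [uv -> ->]]]].
  case=> [yz|[u [v [uv eu ->]]]]; first by left; exact: Et xy yz.
  right; exists u, v; split=> //; move: xy; rewrite eu => /Es.
  by move/shift_equiv_crown_point.
case=> [/shift_equiv_crown_point <-|[v' [w [vw /crown_point_inj e _]]]].
  by right; exists u, v.
by move: vw; rewrite -e => /(crown_lt_asym uv).
Qed.

Lemma measurable_crown_order s : borel_relation (crown_order s).
Proof.
apply: measurable_disj; first exact: measurable_shift_equiv.
rewrite (_ : [set _ | _] = [set p : ambient * ambient | exists u : vertex, exists v : vertex,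
   crown_lt s u v /\ (p.1 = crown_point u /\ p.2 = crown_point v)]); last first.
  by apply/seteqP; split=> p /= [u [v]]; [case=> ? ? ?|case=> ? [? ?]]; exists u, v.
apply: measurable_ex => u; apply: measurable_ex => v; apply: measurable_conj.
  exact: measurable_cstP.
apply: measurable_conj; apply: measurable_eq_bits; try exact: measurable_cst.
  exact: measurable_fst.
exact: measurable_snd.
Qed.

Lemma countableU T (A B : set T) : countable A -> countable B -> countable (A `|` B).
Proof.
move=> cA cB; rewrite (_ : A `|` B = \bigcup_(b in [set: bool]) if b then A else B).
  by apply: bigcup_countable => // -[].
by apply/seteqP; split=> [x [Ax|Bx]|x [[] _ ?]]; [exists true|exists false|left|right].
Qed.

Lemma countable_predecessors s x : countable [set y | crown_order s y x].
Proof.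
apply: (@sub_countable _ _ _ ([set x] `|` range (fun w => shift w x) `|` range crown_point)).
  apply: subset_card_le => y /= [[->|[_ _ [v ->]]]|[u [v [_ -> _]]]].
  - by left; left.
  - by left; right; exists v.
  - by right; exists u.
have cr (T : countType) (f : T -> ambient) : countable (range f).
  by apply: sub_countable (countableP (@setT T)); exact: card_image_le.
by do ?[apply: countableU => //].
Qed.

Lemma crown_order_quasi_order s : countable_borel_quasi_order (crown_order s).
Proof.
split; [exact: crown_order_preorder|exact: measurable_crown_order|].
exact: countable_predecessors.
Qed.

(** * Universality of the shift equivalence *)

Lemma universal_shift_equiv (R : realType) :
  universal_countable_borel_equivalence R shift_equiv.
Proof.
split.
  split; [exact: shift_equiv_equivalence|exact: measurable_shift_equiv|move=> x].
  apply: sub_countable (countable_predecessors (fun=> false) x).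
  by apply: subset_card_le => y xy; left.
move=> d Y F /standard_borel_code[e [r [me mr erK]]] [[Fr Fs Ft] mF cF].
(* Off the codes this is equality, which makes it an equivalence on all of [bits nat]. *)
pose F' (a b : bits nat) := a = b \/ [/\ e (r a) = a, e (r b) = b & F (r a) (r b)].
have eqF' : Equivalence F'.
  split=> [a|a b|a b c]; first by left.
    by case=> [->|[? ? /Fs]]; [left|right].
  case=> [->//|[ra rb ab]] [<-|[_ rc bc]]; right; split=> //.
  exact: Ft ab bc.
have [Er' Es' Et'] := eqF'.
have [f mf Hf] : exists2 f : nat -> bits nat -> bits nat,
    (forall m, measurable_fun setT (f m)) & forall x y, F' x y <-> exists m, y = f m x.
  apply: countable_equivalence_functions; split=> //.
  - pose C2 := (bits nat * bits nat)%type.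
    have m1 : measurable_fun setT (fst : C2 -> _) by exact: measurable_fst.
    have m2 : measurable_fun setT (snd : C2 -> _) by exact: measurable_snd.
    rewrite /borel_relation (_ : [set _ | _] = [set p : C2 | p.1 = p.2 \/
      (e (r p.1) = p.1 /\ (e (r p.2) = p.2 /\ F (r p.1) (r p.2)))]); last first.
      by apply/seteqP; split=> p /= [->|]; [left|case=> ? ? ?; right|left|case=> ? [? ?]; right].
    apply: measurable_disj; first exact: measurable_eq_bits.
    apply: measurable_conj.
      apply: measurable_eq_bits => //; do 2!apply: measurableT_comp => //.
    apply: measurable_conj.
      apply: measurable_eq_bits => //; do 2!apply: measurableT_comp => //.
    apply: (@measurable_preim _ _ _ _ (fun p : C2 => (r p.1, r p.2)) _ _ mF).
    by apply: measurable_fun_pair; exact: measurableT_comp.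
  - move=> a; apply: (@sub_countable _ _ _ ([set a] `|` e @` [set y | F y (r a)])).
      apply: subset_card_le => b /= [->|[rb ra ba]]; first by left.
      by right; exists (r b).
    apply: countableU => //; apply: sub_countable (cF (r a)); exact: card_image_le.
(* Letters act from left to right, so that shifting by [w] amounts to running [w] first. *)
pose run := fix run (w : seq nat) (x : bits nat) := if w is m :: w' then run w' (f m x) else x.
have run_cat v w x : run (v ++ w) x = run w (run v x) by elim: v x => //=.
have mrun w : measurable_fun setT (run w).
  elim: w => [|m w IH] /=; first exact: measurable_id.
  by apply: measurableT_comp.
have Frun w x : F' x (run w x).
  elim: w x => [|m w IH] x /=; first exact: Er'.
  by apply: Et' (IH _); apply/Hf; exists m.
(* The flag is on, so that shifts can relate this point to others. *)
pose word (x : bits nat) : ambient := fun k => if k is Some (w, n) then run w x n else true.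
have shift_word w x : shift w (word x) = word (run w x).
  by apply/funext => -[[v n]|] //=; rewrite /shift /= run_cat.
have word_inj : injective word.
  move=> x y exy; apply/funext => n.
  by have := congr1 (fun f => f (Some ([::], n))) exy.
exists (word \o e) => [|x y].
  apply: measurableT_comp => //; apply: measurable_to_bits => -[[w n]|] /=.
    exact: measurable_coord.
  exact: measurable_cstP.
have FF' : F x y <-> F' (e x) (e y).
  split=> [xy|[/(can_inj erK) ->//|[_ _]]]; last by rewrite !erK.
  by right; rewrite !erK.
rewrite FF' /=; split=> [xy|].
  right; split=> //.
    have [m ->] := (Hf _ _).1 xy; exists [:: m]; by rewrite shift_word.
  have [m ->] := (Hf _ _).1 (Es' _ _ xy); exists [:: m]; by rewrite shift_word.
case=> [/word_inj ->//|[_ [w]]].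
by rewrite shift_word => /word_inj -> _; exact: Frun.
Qed.

(** * Non-reducibility between the quasi-orders *)

Lemma crown_order_separation (s t : nat -> bool) m : s m -> ~~ t m ->
  ~ borel_reducible (crown_order s) (crown_order t).
Proof.
move=> sm tm [f _ Hf].
pose idx i := iter i (cyc m.+2) 0.
have idx_lt i : (idx i < m.+2)%N by exact: iter_cyc_lt.
(* If the images were equivalent, reducing back would reverse the comparison of [u] and [v]; and in
   the target only vertices are strictly comparable. *)
have strict u v : crown_lt s u v -> exists u' v',
    [/\ crown_lt t u' v', f (crown_point u) = crown_point u' &
        f (crown_point v) = crown_point v'].
  move=> uv.
  have : crown_order s (crown_point u) (crown_point v) by right; exists u, v.
  move=> /Hf[/shift_equiv_sym h|//].
  have : crown_order s (crown_point v) (crown_point u) by apply/Hf; left.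
  case=> [/shift_equiv_crown_point/crown_point_inj e|].
    by move: uv; rewrite e => uv; have := crown_lt_asym uv uv.
  move=> [v' [u' [vu /crown_point_inj e _]]].
  by move: vu; rewrite -e => /(crown_lt_asym uv).
have lt1 i : crown_lt s (m, (idx i, false)) (m, (idx i, true)).
  by split; [ | |split; exact: idx_lt|left].
have lt2 i : crown_lt s (m, (idx i, false)) (m, (idx i.+1, true)).
  by split; [ | |split; exact: idx_lt|right].
have /choice[al Hal] : forall i, exists u, f (crown_point (m, (idx i, false))) = crown_point u.
  by move=> i; have [u [v [_ e _]]] := strict _ _ (lt1 i); exists u.
have /choice[be Hbe] : forall i, exists u, f (crown_point (m, (idx i, true))) = crown_point u.
  by move=> i; have [u [v [_ _ e]]] := strict _ _ (lt1 i); exists v.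
(* Equal images make the two vertices equivalent, and vertices are alone in their classes. *)
have finj u v : f (crown_point u) = f (crown_point v) -> u = v.
  move=> e; apply: crown_point_inj; apply: shift_equiv_crown_point.
  rewrite -(assoc_crown_order s); split; apply/Hf; rewrite e; left; left => //.
suff : t m by rewrite (negbTE tm).
apply: (@crown_embedding t m al be) => //.
- move=> i; split.
    have [u [v [uv]]] := strict _ _ (lt1 i).
    by rewrite Hal Hbe => /crown_point_inj -> /crown_point_inj ->.
  have [u [v [uv]]] := strict _ _ (lt2 i).
  by rewrite Hal Hbe => /crown_point_inj -> /crown_point_inj ->.
- by move=> i j e; have := finj (m, (idx i, false)) (m, (idx j, false));
    rewrite !Hal e => /(_ erefl)[].
- by move=> i j e; apply: crown_point_inj; rewrite -!Hal /idx e.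
- by move=> i j e; have := finj (m, (idx i, true)) (m, (idx j, true));
    rewrite !Hbe e => /(_ erefl)[].
Qed.

(* A family of countable Borel quasi-orders indexed by 2^nat. *)
Theorem theorem7p1 (R : realType) :
  exists (d : (nat -> bool) -> measure_display)
         (X : forall s : nat -> bool, measurableType (d s))
         (Q : forall s : nat -> bool, X s -> X s -> Prop),
    [/\ forall s, standard_borel R (X s),
        forall s, countable_borel_quasi_order (Q s),
        forall s, universal_countable_borel_equivalence R (assoc_equiv (Q s)) &
        forall s t, s <> t -> ~ borel_bireducible (Q s) (Q t)].
Proof.
exists (fun=> bits_display), (fun=> ambient), crown_order; split.
- by move=> s; exact: standard_borel_bits.
- exact: crown_order_quasi_order.
- by move=> s; rewrite assoc_crown_order; exact: universal_shift_equiv.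
(* A crown present on one side only excludes the reduction from that side. *)
- move=> s t st [rst rts]; apply: st; apply/funext => m.
  case sm : (s m); case tm : (t m) => //.
    by case: (@crown_order_separation s t m); rewrite // tm.
  by case: (@crown_order_separation t s m); rewrite // sm.
Qed.
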